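(* Let $u_i=(\cos\theta_i,\sin\theta_i)$, $i=1,2,3$, with $\theta_i\in\mathbb{R}$, be unit vectors of $\mathbb{R}^2$ such that the directions (lines) $\mathbb{R}u_1,\mathbb{R}u_2,\mathbb{R}u_3$ are pairwise distinct. There exist three positive numbers $c_1,c_2,c_3$ such that $$c_1\,u_1\otimes u_1+c_2\,u_2\otimes u_2+c_3\,u_3\otimes u_3=\mathrm{Id}_{\mathbb{R}^2}$$ if and only if the three geometric angles given by the six angular sectors defined by these three lines are all strictly smaller than $\frac{\pi}{2}$. In that case the $c_i$'s are given by $$c_i=\frac{\cos(\theta_j-\theta_k)}{\sin(\theta_j-\theta_i)\sin(\theta_k-\theta_i)}=1-\cot(\theta_i-\theta_j)\cot(\theta_k-\theta_i)$$ for $(i,j,k)$ any permutation of $(1,2,3)$.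
   Context: For a unit vector $u\in\mathbb{R}^2$, $u\otimes u$ denotes the orthogonal projection onto the line $\mathbb{R}u$, i.e. $(u\otimes u)(v)=(v\cdot u)u$. Three distinct lines through the origin cut the plane into six open angular sectors, which come in three opposite pairs of equal angle; these are the three geometric angles (they sum to $\pi$). Explicitly, if the lines are relabeled and the $\theta_i$ changed by multiples of $\pi$ and a common rotation so that $0=\theta_1<\theta_2<\theta_3<\pi$, the three angles are $\theta_2$, $\theta_3-\theta_2$ and $\pi-\theta_3$. *)

(* Defs.v *)
From HB Require Import structures.
From mathcomp Require Import all_boot all_order all_algebra all_fingroup.
From mathcomp Require Import boolp reals trigo.

Set Implicit Arguments.
Unset Strict Implicit.
Unset Printing Implicit Defensive.

Import Order.TTheory GRing.Theory Num.Theory.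
Local Open Scope ring_scope.

Definition dot (R : realType) (v u : 'cV[R]_2) : R := \sum_(i < 2) v i 0 * u i 0.

Definition tens_fun (R : realType) (u v : 'cV[R]_2) : 'cV[R]_2 := dot v u *: u.

Lemma tens_fun_is_linear (R : realType) (u : 'cV[R]_2) : linear (tens_fun u).
Proof.
move=> a v w; rewrite /tens_fun /dot scalerA -scalerDl; congr (_ *: _).
rewrite mulr_sumr -big_split /=; apply: eq_bigr => i _.
by rewrite !mxE mulrDl mulrA.
Qed.

HB.instance Definition _ (R : realType) (u : 'cV[R]_2) :=
  GRing.isLinear.Build R 'cV[R]_2 'cV[R]_2 *:%R (tens_fun u)
    (tens_fun_is_linear u).

(* u (x) u, as an endomorphism of R^2. *)
Definition tens (R : realType) (u : 'cV[R]_2) : 'End('cV[R]_2) :=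
  linfun (tens_fun u).

Lemma tensE (R : realType) (u v : 'cV[R]_2) : tens u v = dot v u *: u.
Proof. by rewrite lfunE. Qed.

Definition dir (R : realType) (t : R) : 'cV[R]_2 :=
  \col_(i < 2) (if i == 0 then cos t else sin t).

(* As for tan in the library, the value where sin x = 0 is the junk value 0. *)
Definition cot (R : realType) (x : R) : R := cos x / sin x.

(* theta' is obtained from theta by relabelling the lines (s), adding multiples
   of pi (k) and a common rotation (phi), so that
   0 = theta'_0 < theta'_1 < theta'_2 < pi. *)
Definition normalization (R : realType) (theta theta' : 'I_3 -> R) : Prop :=
  (exists (s : 'S_3) (k : 'I_3 -> int) (phi : R),
     forall i, theta' i = theta (s i) + (k i)%:~R * pi + phi) /\
  [/\ theta' 0 = 0, 0 < theta' 1, theta' 1 < theta' 2%:R & theta' 2%:R < pi].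

(* The three angles cut by the lines R (dir (theta i)) are those read off a
   normalization; which normalization is used only permutes them. *)
Definition geometric_angle (R : realType) (theta : 'I_3 -> R) (a : R) : Prop :=
  exists2 theta' : 'I_3 -> R, normalization theta theta' &
    a \in [:: theta' 1; theta' 2%:R - theta' 1; pi - theta' 2%:R].

Lemma dirDpi (R : realType) (t : R) : dir (t + pi) = - dir t.
Proof.
by apply/colP => i; rewrite !mxE cosDpi sinDpi; case: ifP.
Qed.

Lemma line_dirDnatpi (R : realType) (t : R) (n : nat) :
  <[dir (t + n%:R * pi)]>%VS = <[dir t]>%VS.
Proof.
elim: n => [|n IHn]; first by rewrite mul0r addr0.
rewrite -natr1 mulrDl mul1r addrA dirDpi -IHn.
by apply/eqP; rewrite eqEsubv -!memvE memvN memv_line -memvN memv_line.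
Qed.

Lemma line_dirDintpi (R : realType) (t : R) (k : int) :
  <[dir (t + k%:~R * pi)]>%VS = <[dir t]>%VS.
Proof.
case: (intP k) => [|n|n]; rewrite ?mul0r ?addr0 //.
  by rewrite -[X in X * _]/(n.+1%:R) line_dirDnatpi.
by rewrite mulrNz mulNr -[LHS](line_dirDnatpi _ n.+1) -addrA addNr addr0.
Qed.

(* So geometric_angle is never vacuous on three distinct lines. *)
Lemma normalization_exists (R : realType) (theta : 'I_3 -> R) :
  injective (fun i => <[dir (theta i)]>%VS) ->
  exists theta', normalization theta theta'.
Proof.
move=> inj; have pi0 := pi_gt0 R; have pin0 : (pi : R) != 0 by rewrite gt_eqF.
pose k i : int := - Num.floor ((theta i - theta 0) / pi).
pose x i := theta i + (k i)%:~R * pi - theta 0.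
have xE i : x i = ((theta i - theta 0) / pi - (Num.floor ((theta i - theta 0) / pi))%:~R) * pi.
  by rewrite /x /k [RHS]mulrBl divfK // mulrNz mulNr addrAC.
have x_ge0 i : 0 <= x i.
  by rewrite xE mulr_ge0 ?(ltW pi0) // subr_ge0 real_floor_le ?num_real.
have x_lt i : x i < pi.
  by rewrite xE -[ltRHS]mul1r ltr_pM2r // ltrBlDl -(intrD _ _ 1) real_floorD1_gt ?num_real.
have x0 : x 0 = 0 by rewrite xE subrr mul0r floor0 subrr mul0r.
have xinj : injective x.
  move=> i j /addIr eq_ij; apply: inj => /=.
  by rewrite -(line_dirDintpi (theta i) (k i)) eq_ij line_dirDintpi.
have x_gt0 i : i != 0 -> 0 < x i.
  by move=> i0; rewrite lt_def x_ge0 andbT -x0 (inj_eq xinj).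
have : x 1 != x 2%:R by rewrite (inj_eq xinj).
rewrite neq_lt => /orP[lt12|lt21].
  exists x; split; first by exists 1%g, k, (- theta 0) => i; rewrite perm1.
  by split; rewrite ?x_gt0.
pose s : 'S_3 := tperm 1 2%:R.
exists (x \o s); split; first by exists s, (k \o s), (- theta 0).
by rewrite /= tpermL tpermR tpermD //; split; rewrite ?x_gt0.
Qed.

(* Main.v *)
(* The identity sum_i c_i u_i (x) u_i = Id amounts to
   sum_i c_i cos (theta_i - a) cos (theta_i - b) = cos (a - b) for all a, b.
   Taking a and b normal to the lines j and k kills two terms and gives
   c_i sin (theta_j - theta_i) sin (theta_k - theta_i) = cos (theta_j - theta_k).
   For 0 = theta_1 < theta_2 < theta_3 < pi the sines have known signs, so each
   c_i has the sign of the cosine of one geometric angle; conversely these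
   formulas always define a solution.  Relabelling, rotating and adding
   multiples of pi do not affect the family of identities in a and b. *)
Require Import Defs.
From HB Require Import structures.
From mathcomp Require Import all_boot all_order all_algebra all_fingroup.
From mathcomp Require Import boolp reals trigo.
From mathcomp Require Import ring lra.

Set Implicit Arguments.
Unset Strict Implicit.
Unset Printing Implicit Defensive.

Import Order.TTheory GRing.Theory Num.Theory.
Local Open Scope ring_scope.

Lemma dot_dir (R : realType) (a b : R) : dot (dir a) (dir b) = cos (a - b).
Proof. by rewrite /dot big_ord_recl big_ord1 !mxE /= cosB. Qed.

Lemma dotDl (R : realType) (u v w : 'cV[R]_2) :
  dot (u + v) w = dot u w + dot v w.
Proof. by rewrite /dot -big_split; apply: eq_bigr => i _; rewrite mxE mulrDl. Qed.

Lemma dotZl (R : realType) (a : R) (u w : 'cV[R]_2) :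
  dot (a *: u) w = a * dot u w.
Proof. by rewrite /dot mulr_sumr; apply: eq_bigr => i _; rewrite mxE mulrA. Qed.

Lemma dot_dir0 (R : realType) (v : 'cV[R]_2) : dot v (dir 0) = v 0 0.
Proof.
by rewrite /dot big_ord_recl big_ord1 !mxE /= cos0 sin0 mulr1 mulr0 addr0.
Qed.

Lemma dot_dir_pihalf (R : realType) (v : 'cV[R]_2) :
  dot v (dir (pi / 2)) = v 1 0.
Proof.
rewrite /dot big_ord_recl big_ord1 !mxE /= cos_pihalf sin_pihalf mulr1 mulr0 add0r.
by congr (v _ _); apply: val_inj.
Qed.

Lemma dot_dir_inj (R : realType) (v w : 'cV[R]_2) :
  (forall b, dot v (dir b) = dot w (dir b)) -> v = w.
Proof.
move=> vw; apply/colP => i; have [->|->] : i = 0 \/ i = 1.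
- by case: i => [[|[|//]] ?]; [left|right]; apply: val_inj.
- by rewrite -!dot_dir0.
- by rewrite -!dot_dir_pihalf.
Qed.

Lemma dir_span (R : realType) (v : 'cV[R]_2) :
  v = v 0 0 *: dir 0 + v 1 0 *: dir (pi / 2).
Proof.
apply: dot_dir_inj => b; rewrite dotDl !dotZl !dot_dir !cosB.
rewrite cos0 sin0 cos_pihalf sin_pihalf /dot big_ord_recl big_ord1 !mxE /=.
rewrite (_ : lift _ _ = 1) //; first by ring.
exact: val_inj.
Qed.

Definition resolution (R : realType) (theta c : 'I_3 -> R) : Prop :=
  forall a b,
    \sum_(i < 3) c i * (cos (theta i - a) * cos (theta i - b)) = cos (a - b).

(** Pairing the image of [dir a] with [dir b] turns the two endomorphisms into the two sides of
    [resolution]. These pairings determine an endomorphism because [dir 0] and [dir (pi / 2)] form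
    an orthonormal basis. *)
Lemma resolutionP (R : realType) (theta c : 'I_3 -> R) :
  \sum_(i < 3) c i *: tens (dir (theta i)) = \1%VF <-> resolution theta c.
Proof.
have E a b : dot ((\sum_(i < 3) c i *: tens (dir (theta i)))%R (dir a)) (dir b)
    = \sum_(i < 3) c i * (cos (theta i - a) * cos (theta i - b)).
  rewrite sum_lfunE !big_ord_recl !big_ord0 !dotDl !scale_lfunE !tensE !dotZl.
  rewrite !dot_dir !(cosB a) !cosB /dot big1 => [|? _]; last by rewrite mxE mul0r.
  ring.
split=> [id1 a b|res]; first by rewrite -E id1 id_lfunE dot_dir.
apply/lfunP => v; rewrite id_lfunE {1}(dir_span v) linearD !linearZ /=.
rewrite [RHS](dir_span v).
by congr (_ *: _ + _ *: _); apply: dot_dir_inj => b; rewrite E res dot_dir.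
Qed.

Lemma cosDintpi_sq (R : realType) (x y : R) (k : int) :
  cos (x + k%:~R * pi) * cos (y + k%:~R * pi) = cos x * cos y.
Proof.
have N (n : nat) (u v : R) :
    cos (u + n%:R * pi) * cos (v + n%:R * pi) = cos u * cos v.
  elim: n => [|n IHn]; first by rewrite mul0r !addr0.
  by rewrite -natr1 mulrDl mul1r !(addrA _ (_ * _)) !cosDpi mulrNN.
case: (intP k) => [|n|n]; rewrite ?mul0r ?addr0 //; first exact: (N n.+1).
(* A negative shift is undone by the natural shift [N] applied at the shifted points. *)
rewrite mulrNz mulNr -(N n.+1 (x - _)) !subrK; exact: erefl.
Qed.

(** The permutation reindexes the sum, the sign from each multiple of [pi] occurs twice in a
    product, and [phi] is absorbed by translating [a] and [b] together, which preserves [a - b]. *)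
Lemma resolution_shift (R : realType) (theta theta' c : 'I_3 -> R)
    (s : 'S_3) (k : 'I_3 -> int) (phi : R) :
  (forall i, theta' i = theta (s i) + (k i)%:~R * pi + phi) ->
  resolution theta' (c \o s) <-> resolution theta c.
Proof.
move=> th'.
have E a b :
    \sum_(i < 3) (c \o s) i * (cos (theta' i - a) * cos (theta' i - b)) =
    \sum_(i < 3) c i * (cos (theta i - (a - phi)) * cos (theta i - (b - phi))).
  rewrite [RHS](reindex_inj (@perm_inj _ s)); apply: eq_bigr => i _ /=.
  rewrite -[in RHS](cosDintpi_sq _ _ (k i)) th'.
  by congr (_ * (cos _ * cos _)); ring.
split=> res a b; last by rewrite E res; congr cos; ring.
have := res (a + phi) (b + phi); rewrite E !addrK => ->.
by congr cos; ring.
Qed.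

Lemma resolution_coef (R : realType) (theta c : 'I_3 -> R) (i j k : 'I_3) :
  resolution theta c -> uniq [:: i; j; k] ->
  c i * (sin (theta j - theta i) * sin (theta k - theta i)) =
  cos (theta j - theta k).
Proof.
move=> res ijk.
have := res (theta j + pi / 2) (theta k + pi / 2).
have C (x y : R) : cos (x - (y + pi / 2)) = sin (x - y).
  by rewrite opprD addrA cosB cos_pihalf sin_pihalf mulr0 mulr1 add0r.
rewrite (bigD1 i) //= big1 ?addr0 => [|l lNi]; last first.
  have : (l == j) || (l == k).
    by move: i j k l ijk lNi {res} => [[|[|[|//]]] ?] [[|[|[|//]]] ?]
      [[|[|[|//]]] ?] [[|[|[|//]]] ?].
  by case/orP => /eqP ->; rewrite !C subrr sin0 ?mul0r ?mulr0.
rewrite !C -[theta i - theta j]opprB -[theta i - theta k]opprB !sinN mulrNN => ->.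
by rewrite addrAC sinD cos_pihalf sin_pihalf mulr0 mulr1 add0r.
Qed.

Lemma sin_line_neq0 (R : realType) (x y : R) :
  <[dir x]>%VS <> <[dir y]>%VS -> sin (x - y) != 0.
Proof.
move=> xNy; apply/eqP => s0; apply: xNy.
have D (u v : R) : sin (u - v) = 0 -> dir u \in <[dir v]>%VS.
  (* By the addition formulas, a vanishing [sin (u - v)] leaves [dir u] equal to [cos (u - v)] times
     [dir v]. *)
  move=> suv; apply/vlineP; exists (cos (u - v)).
  rewrite -{1}(subrK v u); apply/colP => i.
  rewrite !mxE (cosD (u - v)) (sinD (u - v)) suv !mul0r.
  by rewrite subr0 add0r; case: ifP.
apply/eqP; rewrite eqEsubv -!memvE !D //.
by rewrite -opprB sinN s0 oppr0.
Qed.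

Lemma cos_gt0_lt_pihalf (R : realType) (x : R) :
  0 < x < pi -> (0 < cos x) = (x < pi / 2).
Proof.
move=> /andP[x0 xpi]; have pi0 := pi_gt0 R.
rewrite -cos_pihalf ltr_cos // in_itv /= ?(ltW x0) ?(ltW xpi) //.
by apply/andP; split; lra.
Qed.

Lemma resolution0 (R : realType) (theta c : 'I_3 -> R) :
  theta 0 = 0 -> let x := theta 1 in let y := theta 2%:R in
  sin x != 0 -> sin y != 0 -> sin (y - x) != 0 ->
  c 0 = cos (y - x) / (sin x * sin y) ->
  c 1 = - cos y / (sin x * sin (y - x)) ->
  c 2%:R = cos x / (sin y * sin (y - x)) ->
  resolution theta c.
Proof.
move=> th0 x y sx sy; rewrite cosB sinB => sxy c0 c1 c2 a b.
rewrite !big_ord_recl big_ord0.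
rewrite (_ : lift ord0 ord0 = 1); last exact: val_inj.
rewrite (_ : lift ord0 (lift ord0 ord0) = 2%:R); last exact: val_inj.
rewrite (_ : ord0 = 0) // th0 -/x -/y !cosB cos0 sin0.
have e12 : c 1 * (cos x * sin x) + c 2%:R * (cos y * sin y) = 0.
  by rewrite c1 c2; field; rewrite sx sy sxy.
have e22 : c 1 * sin x ^+ 2 + c 2%:R * sin y ^+ 2 = 1.
  by rewrite c1 c2; field; rewrite sx sy sxy.
have e11 : c 0 + c 1 * cos x ^+ 2 + c 2%:R * cos y ^+ 2 = 1.
  by rewrite c0 c1 c2; field; rewrite sx sy sxy.
transitivity
  ((c 0 + c 1 * cos x ^+ 2 + c 2%:R * cos y ^+ 2) * (cos a * cos b)
   + (c 1 * (cos x * sin x) + c 2%:R * (cos y * sin y))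
     * (cos a * sin b + sin a * cos b)
   + (c 1 * sin x ^+ 2 + c 2%:R * sin y ^+ 2) * (sin a * sin b)); first by ring.
by rewrite e11 e12 e22; ring.
Qed.

Theorem proposition4 (R : realType) (theta : 'I_3 -> R)
    (hlines : injective (fun i : 'I_3 => <[dir (theta i)]>%VS)) :
  ((exists c : 'I_3 -> R,
      (forall i, 0 < c i) /\
      \sum_(i < 3) c i *: tens (dir (theta i)) = \1%VF) <->
   (forall a : R, geometric_angle theta a -> a < pi / 2)) /\
  (forall c : 'I_3 -> R,
     (forall i, 0 < c i) ->
     \sum_(i < 3) c i *: tens (dir (theta i)) = \1%VF ->
     forall i j k : 'I_3, uniq [:: i; j; k] ->
       c i = cos (theta j - theta k)
             / (sin (theta j - theta i) * sin (theta k - theta i)) /\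
       c i = 1 - cot (theta i - theta j) * cot (theta k - theta i)).
Proof.
have sin_neq0 i j : i != j -> sin (theta i - theta j) != 0.
  by move=> /eqP ij; apply: sin_line_neq0 => /hlines.
have pi0 := pi_gt0 R.
split; last first.
  move=> c c0 /resolutionP res i j k ijk; have cE := resolution_coef res ijk.
  move: ijk; rewrite /= !inE negb_or !andbT => /andP[/andP[ij ik] jk].
  have sji : sin (theta j - theta i) != 0 by rewrite sin_neq0 // eq_sym.
  have ski : sin (theta k - theta i) != 0 by rewrite sin_neq0 // eq_sym.
  have {}cE : c i = cos (theta j - theta k)
      / (sin (theta j - theta i) * sin (theta k - theta i)).
    by rewrite -cE mulfK // mulf_neq0.
  split=> //; rewrite cE -(opprB (theta j) (theta i)) /cot cosN sinN.
  (* Dividing the expansion of cos (A - B) by sin A sin B gives 1 + cot A cot B; the minus sign of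
     the statement comes from the oddness of [cot]. *)
  rewrite (_ : theta j - theta k = (theta j - theta i) - (theta k - theta i));
    last by ring.
  by rewrite cosB; field; rewrite sji ski.
have sines (x y : R) : 0 < x -> x < y -> y < pi ->
    [/\ 0 < sin x, 0 < sin y & 0 < sin (y - x)].
  by move=> x0 xy ypi; split; apply: sin_gt0_pi; apply/andP; split; lra.
split=> [[c [c0 /resolutionP res]] a
  [th' [[s [k [phi th'E]]] [t0 t1 t12 t2]]]|acute].
  have {}res : resolution th' (c \o s) by apply/(resolution_shift _ th'E).
  have [sx sy sxy] := sines _ _ t1 t12 t2.
  have cE i j l := @resolution_coef _ _ _ i j l res.
  have c1 := c0 (s 1); have c2 := c0 (s 2%:R); have {}c0 := c0 (s 0).
  (* Each coefficient controls the angle between the other two lines: index 0 the middle one, index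
     2 the angle [th' 1], and index 1 the angle [pi - th' 2%:R], whose cosine is
     [- cos (th' 2%:R)]. *)
  have := cE 0 2%:R 1 isT; have := cE 1 2%:R 0 isT; have := cE 2%:R 1 0 isT.
  rewrite /= t0 !subr0 !sub0r -(opprB (th' 2%:R)) !sinN => e2 e1 e0.
  rewrite !inE => /or3P[] /eqP ->; rewrite -cos_gt0_lt_pihalf;
    try by apply/andP; split; lra.
  - by rewrite -e2 mulrNN !mulr_gt0.
  - by rewrite -e0 !mulr_gt0.
  - rewrite addrC cosDpi cosN -e1.
    by rewrite mulrN mulrN opprK !mulr_gt0.
have [th' nth'] := normalization_exists hlines.
have ac a : a \in [:: th' 1; th' 2%:R - th' 1; pi - th' 2%:R] -> a < pi / 2.
  by move=> ?; apply: acute; exists th'.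
case: nth' => [[s [k [phi th'E]]] [t0 t1 t12 t2]].
have [sx sy sxy] := sines _ _ t1 t12 t2.
have cx : 0 < cos (th' 1).
  rewrite cos_gt0_lt_pihalf ?ac ?inE ?eqxx //; apply/andP; split; lra.
have cxy : 0 < cos (th' 2%:R - th' 1).
  rewrite cos_gt0_lt_pihalf ?ac ?inE ?eqxx ?orbT //; apply/andP; split; lra.
have cy : 0 < - cos (th' 2%:R).
  rewrite -cosN -cosDpi addrC.
  rewrite cos_gt0_lt_pihalf ?ac ?inE ?eqxx ?orbT //; apply/andP; split; lra.
(* These values are forced by [resolution_coef], with signs moved so that every factor is
   positive. *)
pose c' (i : 'I_3) := if i == 0 then
    cos (th' 2%:R - th' 1) / (sin (th' 1) * sin (th' 2%:R))
  else if i == 1 then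
    - cos (th' 2%:R) / (sin (th' 1) * sin (th' 2%:R - th' 1))
  else cos (th' 1) / (sin (th' 2%:R) * sin (th' 2%:R - th' 1)).
have res : resolution th' c' by apply: resolution0; rewrite ?gt_eqF.
(* Position [i] of [th'] carries the original line [s i], so its coefficient is transported back
   through the inverse of [s]. *)
exists (c' \o s^-1%g); split=> [i|].
  rewrite /= /c'; case: ifP => _; last case: ifP => _;
    by rewrite divr_gt0 // mulr_gt0.
apply/resolutionP/(resolution_shift _ th'E).
by congr (resolution _ _): res; apply/funext => i /=; rewrite permK.
Qed.
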